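(* Let $\sigma=\{\sigma_i\mid i\in I\}$ be a partition of the set of all primes and let $G$ be a finite group. Suppose that $G$ has a $\sigma$-nilpotent normal Hall subgroup $D$ with $G/D$ $\sigma$-nilpotent such that $G/O^{\sigma_i}(D)$ is a special $P\sigma T$-group for each $\sigma_i\in\sigma(D)$. Then $G$ is a $P\sigma T$-group.
   Context: All groups are finite. $\sigma=\{\sigma_i\mid i\in I\}$ is a partition of the set $\mathbb{P}$ of primes. For $n\in\mathbb{N}$, $\sigma(n)=\{\sigma_i\mid \sigma_i\cap\pi(n)\ne\emptyset\}$ with $\pi(n)$ the primes dividing $n$; $\sigma(G)=\sigma(|G|)$. A group is $\sigma$-primary if $|\sigma(G)|\le1$, a $\sigma_i$-group if all prime divisors of its order lie in $\sigma_i$, and $\sigma$-nilpotent if it is a direct product of $\sigma$-primary groups. $O^{\sigma_i}(D)$ denotes the smallest normal subgroup of $D$ whose quotient is a $\sigma_i$-group. A Hall $\sigma_i$-subgroup of $G$ is a subgroup whose order is a $\sigma_i$-number and whose index has no prime divisor in $\sigma_i$. The $\sigma$-nilpotent residual $G^{\mathfrak{N}_\sigma}$ is the intersection of all normal subgroups $N$ of $G$ with $G/N$ $\sigma$-nilpotent. A power automorphism of a group $D$ is an automorphism mapping every subgroup of $D$ onto itself; an element of $G$ induces a power automorphism in a normal subgroup $D$ if conjugation by it is a power automorphism of $D$. $G$ is a special $P\sigma T$-group if $D_0=G^{\mathfrak{N}_\sigma}$ is contained in a Hall $\sigma_i$-subgroup $E$ of $G$ for some $i$ and: (i) $D_0$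 is a Hall subgroup of $G$ and every element of $G$ induces a power automorphism in $D_0$; (ii) $D_0$ has a normal complement $S$ in $E$. A complete Hall $\sigma$-set of $G$ is a set $\mathcal{H}$ of subgroups such that every nontrivial member is a Hall $\sigma_i$-subgroup for some $i$ and $\mathcal{H}$ contains exactly one Hall $\sigma_i$-subgroup of $G$ for each $\sigma_i\in\sigma(G)$. A subgroup $A$ is $\sigma$-quasinormal in $G$ if $G$ has a complete Hall $\sigma$-set $\mathcal{H}$ with $AH^x=H^xA$ for all $H\in\mathcal{H}$, $x\in G$. $G$ is a $P\sigma T$-group if whenever $K$ is $\sigma$-quasinormal in $H$ and $H$ is $\sigma$-quasinormal in $G$, then $K$ is $\sigma$-quasinormal in $G$. *)

(* Defs.v *)
From Stdlib Require ClassicalEpsilon.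
From mathcomp Require Import all_boot all_fingroup all_solvable.
Set Implicit Arguments. Unset Strict Implicit. Unset Printing Implicit Defensive.
Import GroupScope.
Open Scope group_scope.

(* A partition sigma = {sigma_i | i in I} of the primes is represented by a
   map [sigma : nat -> I] sending each prime p to the index i of the unique
   class sigma_i containing p (values on non-primes are irrelevant). *)

Definition asb (P : Prop) : bool :=
  if ClassicalEpsilon.excluded_middle_informative P then true else false.

Section Sigma.
Variables (I : eqType) (sigma : nat -> I).

Definition sig (i : I) : nat_pred := [pred p | sigma p == i].

Definition sig_of (n : nat) (i : I) : bool := has (fun p => sigma p == i) (primes n).


Definition sig_primary {gT : finGroupType} (G : {set gT}) : Prop :=
  forall i j, sig_of #|G| i -> sig_of #|G| j -> i = j.

Definition sig_nilpotent {gT : finGroupType} (G : {set gT}) : Prop :=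
  exists Hs : seq {group gT},
    \big[dprod/1]_(H <- Hs) (H : {set gT}) = G /\
    (forall H, H \in Hs -> sig_primary H).

Definition sig_nil_res {gT : finGroupType} (G : {set gT}) : {set gT} :=
  \bigcap_(N : {group gT} | (N <| G) && asb (sig_nilpotent (G / N))) (N : {set gT}).

Definition Osig {gT : finGroupType} (i : I) (D : {set gT}) : {set gT} :=
  \bigcap_(N : {group gT} | (N <| D) && (sig i).-group (D / N)) (N : {set gT}).

Definition power_aut_elt {gT : finGroupType} (x : gT) (D : {set gT}) : Prop :=
  forall H : {group gT}, H \subset D -> H :^ x = H.

Definition special_PsT {gT : finGroupType} (G : {set gT}) : Prop :=
  let D0 := sig_nil_res G in
  exists i (E : {group gT}),
    [/\ (sig i).-Hall(G) E, D0 \subset E,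
        Hall G D0 /\ (forall x, x \in G -> power_aut_elt x D0) &
        exists S : {group gT}, S ><| D0 = E].

Definition complete_Hall_set {gT : finGroupType} (G : {set gT}) (HH : {set {group gT}}) : Prop :=
  (forall H : {group gT}, H \in HH -> H != 1 :> {set gT} ->
     exists i, (sig i).-Hall(G) H) /\
  (forall i, sig_of #|G| i ->
     exists H : {group gT}, [/\ H \in HH, (sig i).-Hall(G) H &
        forall H' : {group gT}, H' \in HH -> (sig i).-Hall(G) H' -> H' = H]).

Definition sig_quasinormal {gT : finGroupType} (A G : {set gT}) : Prop :=
  A \subset G /\
  exists HH : {set {group gT}}, complete_Hall_set G HH /\
    forall H : {group gT}, H \in HH -> forall x, x \in G ->
      A * (H :^ x) = (H :^ x) * A.

Definition PsT {gT : finGroupType} (G : {set gT}) : Prop :=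
  forall K H : {group gT},
    sig_quasinormal K H -> sig_quasinormal H G -> sig_quasinormal K G.

End Sigma.

(* Main.v *)
(* Lifting the residuals of the quotients G / O^{sigma_i}(D) to G and
   intersecting them with D gives a normal Hall subgroup R of G such that G / R
   is sigma-nilpotent, G normalises every subgroup of R, and elements of R and
   of G of orders powers of distinct primes of one class sigma_i commute.

   In such a G the sigma-quasinormal subgroups are exactly the subgroups A
   normalised by R.  If A is sigma-quasinormal, take a p-element r of R and a
   q-element b of A with p, q in different classes, and let P be the member of
   the Hall set for the class of q.  A conjugate of P contains b, hence a
   conjugate Q of P contains b^r, and the p-element [b, r] lies in the group
   A Q, whose index over A is prime to p; as <[b, r]> is normal, it lies in A.
   Conversely, let M be a complement of R.  If R normalises A, then
   A = (A :&: R) (A :&: M), which permutes with the conjugates of the Hall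
   subgroups O_{sigma_i}(R) O_{sigma_i}(M).

   For K sigma-quasinormal in H and H in G, R normalises H and R :&: H
   normalises K, so coprime action of the elements of K outside R shows that R
   normalises K. *)
Require Import Defs.
From mathcomp Require Import all_boot all_fingroup all_solvable.
Import GroupScope.
Open Scope group_scope.
Set Implicit Arguments.
Unset Strict Implicit.

(** * Preliminaries on elements of prime power order and coprime complements *)

Lemma sub_of_pelts (gT : finGroupType) (A N : {group gT}) :
  (forall p x, prime p -> x \in A -> p.-elt x -> x \in N) -> A \subset N.
Proof.
move=> AN; apply/subsetP=> x Ax; rewrite -[x]prod_constt.
apply: group_prod => p _.
have Axp: x.`_p \in A by rewrite groupX.
(* The decomposition runs over all [p] up to the order of [x]; at a nonprime [p] the factor is
   trivial. *)
have [p_pr | p_npr] := boolP (prime p).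
  by apply: AN p_pr Axp _; apply: p_elt_constt.
have -> : x.`_p = 1.
  apply/constt1P; apply/pgroupP=> q q_pr _.
  by rewrite !inE; apply: contraNneq p_npr => <-.
exact: group1.
Qed.

(** The subgroup [K :&: (H <*> B)] complements [H] in [H <*> B] and has the order of [B], so
    conjugacy of complements (Schur-Zassenhaus) applies. *)
Lemma sub_coprime_complement (gT : finGroupType) (H K B : {group gT}) :
  solvable H -> K \subset 'N(H) -> B \subset H * K ->
  coprime #|H| #|K| -> coprime #|H| #|B| ->
  exists2 x, x \in H & B \subset K :^ x.
Proof.
move=> solH nHK sBHK coHK coHB.
have nHB: B \subset 'N(H).
  by apply: subset_trans sBHK _; rewrite mul_subG ?normG.
pose K2 := (K :&: (H <*> B))%G.
have HK2: H * K2 = H * B.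
  rewrite /K2 /= group_modl ?joing_subl //= norm_joinEr //.
  by apply/setIidPr; rewrite -{2}(mulGid H) -mulgA mulgS.
have coHK2: coprime #|H| #|K2| by apply: coprimegS coHK; apply: subsetIl.
have cardK2: #|B| = #|K2|.
  apply/eqP; rewrite -(eqn_pmul2l (cardG_gt0 H)).
  by rewrite -coprime_cardMg // -coprime_cardMg // HK2.
have nHK2: K2 \subset 'N(H) by apply: subset_trans nHK; apply: subsetIl.
have sBK2: B \subset H * K2 by rewrite HK2 mulG_subr.
have [x Hx defB] := SchurZassenhaus_trans_sol solH nHK2 sBK2 coHK2 cardK2.
by exists x => //; rewrite defB conjSg subsetIl.
Qed.

(* For normal N this says that G / N is sigma-nilpotent, in a form that is
   stable under intersections and preimages. *)
Definition sig_nil_mod (I : eqType) (sigma : nat -> I) (gT : finGroupType)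
    (G N : {group gT}) : Prop :=
  forall i, exists L : {group gT},
    [/\ N \subset L, L <| G, (sig sigma i).-nat #|L : N|
      & (sig sigma i)^'.-nat #|G : L|].

(** Here [pr_norm] expresses the power automorphisms, and [pr_comm] is what survives of the normal
    complement in the definition of special groups. *)
Record power_residual (I : eqType) (sigma : nat -> I) (gT : finGroupType)
    (G R : {group gT}) : Prop := PowerResidual {
  pr_normal : R <| G;
  pr_Hall : Hall G R;
  pr_norm : forall U : {group gT}, U \subset R -> G \subset 'N(U);
  pr_nil : sig_nil_mod sigma G R;
  pr_comm : forall p q r b, prime p -> prime q -> p != q ->
    sigma p = sigma q -> r \in R -> b \in G -> p.-elt r -> q.-elt b ->
    commute r b
}.

(** Each element of prime power order generates a normal nilpotent subgroup, hence lies in the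
    Fitting subgroup. *)
Lemma power_residual_nilpotent (I : eqType) (sigma : nat -> I)
    (gT : finGroupType) (G R : {group gT}) :
  power_residual sigma G R -> nilpotent R.
Proof.
case=> nRG _ nU _ _.
suff /setIidPl <-: R \subset 'F(R) by apply: nilpotentS (subsetIr _ _) (Fitting_nil R).
apply: sub_of_pelts => p x p_pr Rx px.
have sxR: <[x]> \subset R by rewrite cycle_subG.
rewrite -cycle_subG; apply: Fitting_max (pgroup_nil px).
by rewrite /normal sxR (subset_trans (normal_sub nRG)) ?nU.
Qed.

Lemma Hall_pi'_or_sub (gT : finGroupType) (G R : {group gT}) p x :
  prime p -> R <| G -> Hall G R -> x \in G -> p.-elt x ->
  coprime #|R| #[x] \/ x \in R.
Proof.
move=> p_pr nRG hallR Gx px.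
have [p_R | p'R] := boolP (p \in \pi(#|R|)).
  right; rewrite (mem_normal_Hall (Hall_pi hallR) nRG Gx).
  by apply: sub_in_pnat px => q _ /eqP->.
left; rewrite coprime_sym; apply: (pnat_coprime px).
by rewrite -p'groupEpi in p'R.
Qed.

Lemma coprime_pelts_neq (gT : finGroupType) (p q : nat) (x y : gT) :
  p.-elt x -> q.-elt y -> coprime #[x] #[y] -> x != 1 -> y != 1 -> p != q.
Proof.
rewrite -!cycle_eq1 => px qy coxy x1 y1; apply: contraTneq coxy => eq_pq.
have [p_pr px' _] := pgroup_pdiv px x1.
rewrite -eq_pq in qy; have [_ py' _] := pgroup_pdiv qy y1.
rewrite /coprime; apply: contraTneq p_pr => co1.
have: p %| 1%N by rewrite -co1 dvdn_gcd; apply/andP.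
by rewrite dvdn1 => /eqP->.
Qed.

(** The order of the coset of [x] divides both coprime numbers. *)
Lemma mem_coprime_index (gT : finGroupType) (G N : {group gT}) x :
  N <| G -> x \in G -> coprime #[x] #|G : N| -> x \in N.
Proof.
move=> nNG Gx co_xN; have nNx := subsetP (normal_norm nNG) x Gx.
rewrite coset_idr // -?order_eq1; apply/eqP; rewrite -order_eq1 -dvdn1.
rewrite -(eqP co_xN) dvdn_gcd morph_order //= -card_quotient ?normal_norm //.
by rewrite order_dvdG // mem_quotient.
Qed.

Lemma index_joing_dvdn (gT : finGroupType) (A B : {group gT}) :
  A * B = B * A -> #|A <*> B : A| %| #|B|.
Proof.
move=> cAB; rewrite -(dvdn_pmul2l (cardG_gt0 A)) Lagrange ?joing_subl //.
by rewrite /= comm_joingE // mul_cardG dvdn_mulr.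
Qed.

Lemma pnat_index_sub (pi : nat_pred) (gT : finGroupType) (L N K : {group gT}) :
  N <| L -> K \subset L -> pi.-nat #|L : N| -> pi.-nat #|K : N|.
Proof.
move=> nNL sKL; have nN := normal_norm nNL.
rewrite -!card_quotient // ?(subset_trans sKL) //.
by apply: pgroupS; apply: quotientS.
Qed.

(** * Sigma-quasinormality as normalisation by the residual *)

(** The form relative to [H] serves transitivity, which applies it both to [H] in [G] and to [K] in
    [H]. *)
Lemma sig_quasinormal_residual_norm (I : eqType) (sigma : nat -> I)
    (gT : finGroupType) (G R A H : {group gT}) :
  power_residual sigma G R -> H \subset G -> sig_quasinormal sigma A H ->
  R :&: H \subset 'N(A).
Proof.
move=> prR sHG [sAH [HH [[_ HHex] permA]]].
have nilR := power_residual_nilpotent prR.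
have [nRG hallR nU nilG commR] := prR.
have sRG := normal_sub nRG.
apply: (@sub_of_pelts _ _ [group of 'N(A)]) => p r p_pr /setIP[Rr Hr] pr.
rewrite /= inE sub_conjg; apply: sub_of_pelts => q b q_pr Ab qb.
have Hb := subsetP sAH b Ab; have Gb := subsetP sHG b Hb.
have Gr := subsetP sRG r Rr; rewrite mem_conjgV.
(* If [b] lies in [R], then [r] normalises the subgroup it generates; only [b] of order prime to
   that of [R] needs work. *)
have [coRb | Rb] := Hall_pi'_or_sub q_pr nRG hallR Gb qb; last first.
  have nbr: r \in 'N(<[b]>) by rewrite (subsetP (nU _ _)) ?cycle_subG.
  have: b ^ r \in <[b]> by rewrite memJ_norm ?cycle_id.
  by apply/subsetP; rewrite cycle_subG.
have [-> | b1] := eqVneq b 1; first by rewrite conj1g group1.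
have [-> | r1] := eqVneq r 1; first by rewrite conjg1.
have corb: coprime #[r] #[b] by apply: coprimeSg coRb; rewrite cycle_subG.
have p_neq_q := coprime_pelts_neq pr qb corb r1 b1.
have [eqs | neqs] := eqVneq (sigma p) (sigma q).
  by rewrite /conjg -(commR p q r b) // mulKg.
set i := sigma q in neqs.
have ib: (sig sigma i).-elt b by apply: sub_in_pnat qb => s _ /eqP->; rewrite !inE.
have [|P [HP hallP _]] := HHex i.
  apply/hasP; exists q; rewrite ?eqxx // mem_primes q_pr cardG_gt0 /=.
  have [_ qb' _] := pgroup_pdiv qb (etrans (congr1 negb (cycle_eq1 b)) b1).
  by apply: dvdn_trans qb' _; rewrite order_dvdG.
have sPH := pHall_sub hallP.
have [L [sRL nLG iL i'L]] := nilG i.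
have sgP: (sig sigma i).-group P := pHall_pgroup hallP.
have Lb: b \in L by apply: (mem_coprime_index nLG Gb); apply: pnat_coprime ib i'L.
have sRH_LH: R :&: H \subset L :&: H by apply: setSI.
(* The indices of [P :&: (L :&: H)] and [R :&: H] in [L :&: H] are coprime, so [L :&: H] is their
   product. Absorbing [R :&: P] into [R :&: H] puts [b] in [(R :&: H) * P0] with [P0] of order prime
   to that of [R]. *)
have [x Hx Pxb]: exists2 x, x \in H & b \in P :^ x.
  have nLH: L :&: H <| H by rewrite setIC; apply: normalGI sHG nLG.
  have defN: (P :&: (L :&: H)) * (R :&: H) = L :&: H.
    apply: coprime_index_mulG; rewrite ?subsetIr //=.
    have /and3P[_ _ i'P] := Hall_setI_normal nLH hallP.
    rewrite coprime_sym; apply: (pnat_coprime _ i'P).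
    have -> : R :&: H = (L :&: H) :&: R by rewrite setIAC (setIidPr sRL).
    rewrite indexgI; apply: (pnat_index_sub _ _ iL); last exact: subsetIl.
    by rewrite /normal sRL (subset_trans (normal_sub nLG)) ?normal_norm.
  have hallPR := setI_normal_Hall nRG (Hall_pi hallR) (subset_trans sPH sHG).
  have nPR: R :&: P <| P by rewrite setIC; apply: normalGI (subset_trans sPH sHG) nRG.
  have /splitsP[P0 complP0] := SchurZassenhaus_split (pHall_Hall hallPR) nPR.
  have [_ defP] := complP complP0.
  move: (complP0); rewrite (compl_pHall _ hallPR) => hallP0.
  have sP0P := pHall_sub hallP0.
  have coRP0: coprime #|R| #|P0|.
    exact: pnat_coprime (pnat_pi (cardG_gt0 R)) (pHall_pgroup hallP0).
  have nRHP: P \subset 'N(R :&: H).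
    rewrite normsI ?(subset_trans sPH) ?normG //.
    by rewrite (subset_trans sHG) ?normal_norm.
  have [x /setIP[_ Hx]]: exists2 x, x \in R :&: H & <[b]> \subset P0 :^ x.
    apply: sub_coprime_complement; first 1 last.
    - exact: subset_trans sP0P nRHP.
    - have sbLH: <[b]> \subset L :&: H by rewrite cycle_subG inE Lb.
      apply: subset_trans sbLH _; rewrite -defN.
      apply: subset_trans (mulSg _ (subsetIl P _)) _.
      rewrite (normC nRHP).
      by rewrite -(mulGSid (setIS R sPH : (R :&: P)%G \subset (R :&: H)%G)) -mulgA defP.
    - by apply: coprimeSg coRP0; apply: subsetIl.
    - by apply: coprimeSg coRb; apply: subsetIl.
    - exact: solvableS (subsetIl _ _) (nilpotent_sol nilR).
  rewrite cycle_subG => P0xb; exists x => //.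
  by apply: subsetP P0xb; rewrite conjSg.
have: [~ b, r] \in A; last by rewrite commgEl groupMl ?groupV.
set z := [~ b, r].
have rz: z \in <[r]>.
  rewrite /z commgEr groupMr ?cycle_id // memJ_norm ?groupV ?cycle_id //.
  by rewrite (subsetP (nU _ _)) ?cycle_subG.
have pz: p.-elt z := mem_p_elt pr rz.
have Rz: z \in R by apply: subsetP rz; rewrite cycle_subG.
pose Q := (P :^ (x * r))%G.
have AQ: A * Q = Q * A by apply: permA; rewrite ?groupM.
have iAQ: (sig sigma i).-nat #|A <*> Q : A|.
  by apply: pnat_dvd (index_joing_dvdn AQ) _; rewrite cardJg.
have zAQ: z \in A <*> Q.
  rewrite /z commgEl groupM ?groupV //.
    by rewrite (subsetP (joing_subl _ _)).
  by rewrite (subsetP (joing_subr _ _)) //= conjsgM memJ_conjg.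
have nzA: A \subset 'N(<[z]>).
  by rewrite (subset_trans sAH) ?(subset_trans sHG) ?nU ?cycle_subG.
have iAz: (sig sigma i).-nat #|A <*> <[z]> : A|.
  apply: pnat_dvd iAQ; rewrite indexSg ?joing_subl //.
  by rewrite join_subG joing_subl cycle_subG.
have pAz: p.-nat #|A <*> <[z]> : A|.
  by apply: pnat_dvd pz; apply: index_joing_dvdn; apply: normC.
have: #|A <*> <[z]> : A| == 1%N.
  apply/eqP; apply: pnat_1 iAz _; apply: sub_in_pnat pAz => s _ /eqP->.
  by rewrite !inE.
by rewrite indexg_eq1 join_subG cycle_subG => /andP[].
Qed.

Lemma sig_quasinormal_trans_norm (I : eqType) (sigma : nat -> I)
    (gT : finGroupType) (G R K H : {group gT}) :
  power_residual sigma G R -> sig_quasinormal sigma K H ->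
  sig_quasinormal sigma H G -> R \subset 'N(K).
Proof.
move=> prR qKH qHG; have [sKH _] := qKH; have [sHG _] := qHG.
have solR := nilpotent_sol (power_residual_nilpotent prR).
have nKRH := sig_quasinormal_residual_norm prR sHG qKH.
have [nRG hallR nU _ _] := prR; have sRG := normal_sub nRG.
have nHR: R \subset 'N(H).
  by have := sig_quasinormal_residual_norm prR (subxx G) qHG; rewrite (setIidPl sRG).
apply/subsetP=> r Rr; rewrite inE sub_conjg; apply: sub_of_pelts => q b q_pr Kb qb.
have Hb := subsetP sKH b Kb; have Gb := subsetP sHG b Hb.
rewrite mem_conjgV.
have [coRb | Rb] := Hall_pi'_or_sub q_pr nRG hallR Gb qb; last first.
  have nbr: r \in 'N(<[b]>).
    by rewrite (subsetP (nU _ _)) ?cycle_subG // (subsetP sRG).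
  have: b ^ r \in <[b]> by rewrite memJ_norm ?cycle_id.
  by apply/subsetP; rewrite cycle_subG.
have nRb: <[b]> \subset 'N(R) by rewrite cycle_subG (subsetP (normal_norm nRG)).
have nRHR: R \subset 'N(R :&: H) by rewrite normsI ?normG.
have sbH: <[b]> \subset H by rewrite cycle_subG.
have sRb: [~: R, <[b]>] \subset R :&: H.
  by rewrite subsetI commg_subl nRb (subset_trans (commgS R sbH)) // commg_subr.
have nRHb: <[b]> \subset 'N(R :&: H) by rewrite normsI // (subset_trans sbH) ?normG.
(* Since [b] acts trivially on [R] modulo [R :&: H], coprime action lifts this whole quotient to the
   centraliser of [b]. *)
have: R \subset (R :&: H) * 'C_R(<[b]>).
  rewrite -quotientSK // (coprime_quotient_cent (subsetIl _ _) nRHb coRb solR).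
  by rewrite subsetI subxx quotient_cents2r.
rewrite -normC; last by rewrite subIset ?nRHR.
move/subsetP/(_ r Rr); case/mulsgP=> z c /setIP[_ cz] RHc ->.
rewrite conjgM (_ : b ^ z = b); last first.
  by apply/conjg_fixP/commgP/commute_sym; apply: (centP cz); rewrite cycle_id.
by rewrite memJ_norm // (subsetP nKRH).
Qed.

Lemma residual_norm_sig_quasinormal (I : eqType) (sigma : nat -> I)
    (gT : finGroupType) (G R A : {group gT}) :
  power_residual sigma G R -> A \subset G -> R \subset 'N(A) ->
  sig_quasinormal sigma A G.
Proof.
move=> prR sAG nAR; have nilR := power_residual_nilpotent prR.
have [nRG hallR nU nilG _] := prR; have [sRG nRG'] := andP nRG.
have /splitsP[M complM] := SchurZassenhaus_split hallR nRG.
have [tiRM defG] := complP complM.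
have hallM: \pi(R)^'.-Hall(G) M by rewrite -(compl_pHall _ (Hall_pi hallR)).
have sMG := pHall_sub hallM.
(* As [M] is isomorphic to [G / R], intersecting it with [L] gives a normal Hall subgroup. *)
have hallOM i : (sig sigma i).-Hall(M) 'O_(sig sigma i)(M).
  have [L [sRL nLG iL i'L]] := nilG i.
  have nLM: M :&: L <| M by apply: normalGI nLG.
  suff hallL: (sig sigma i).-Hall(M) (M :&: L).
    by rewrite (normal_Hall_pcore hallL nLM).
  rewrite /pHall subsetIl /= indexgI (pnat_index_sub nLG sMG i'L) andbT /pgroup.
  have ti: M :&: L :&: R = 1.
    by apply/trivgP; rewrite /= -tiRM setIC setIS ?subsetIl.
  rewrite -indexg1 -ti indexgI; apply: pnat_index_sub iL; last exact: subsetIr.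
  by rewrite /normal sRL (subset_trans (normal_sub nLG)).
pose F p := ('O_(sig sigma (sigma p))(R) <*> 'O_(sig sigma (sigma p))(M))%G.
have nFR p : G \subset 'N('O_(sig sigma (sigma p))(R)).
  exact: char_norm_trans (pcore_char _ _) nRG'.
have defF p : F p = 'O_(sig sigma (sigma p))(R) * 'O_(sig sigma (sigma p))(M) :> {set gT}.
  apply: norm_joinEr; apply: subset_trans (pcore_sub _ _) _.
  exact: subset_trans sMG (nFR p).
have hallF p : (sig sigma (sigma p)).-Hall(G) (F p).
  rewrite pHallE; apply/andP; split.
    by rewrite join_subG !(subset_trans (pcore_sub _ _)).
  rewrite defF TI_cardMg; last first.
    by apply/trivgP; rewrite /= -tiRM setISS ?pcore_sub.
  rewrite (card_Hall (nilpotent_pcore_Hall _ nilR)) (card_Hall (hallOM _)).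
  by rewrite -partnM // -(TI_cardMg tiRM) defG.
(* A complement [C] of [A :&: R] in [A] lies in some [M :^ r] with [r] in [R]; conjugation by [r^-1]
   fixes [A] and carries [C] into [M]. *)
have defA: A = (A :&: R) * (A :&: M) :> {set gT}.
  have nARA: A :&: R <| A by apply: normalGI nRG.
  have hallAR : \pi(R).-Hall(A) (A :&: R).
    by rewrite setIC; apply: setI_normal_Hall (Hall_pi hallR) sAG.
  have /splitsP[C complC] := SchurZassenhaus_split (pHall_Hall hallAR) nARA.
  have [_ defA] := complP complC.
  move: (complC); rewrite (compl_pHall _ hallAR) => hallC.
  have sCA := pHall_sub hallC.
  have [r Rr sCM]: exists2 r, r \in R & C \subset M :^ r.
    apply: sub_coprime_complement (nilpotent_sol nilR) _ _ _ _.
    - exact: subset_trans sMG nRG'.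
    - by rewrite defG (subset_trans sCA).
    - exact: pnat_coprime (pnat_pi (cardG_gt0 R)) (pHall_pgroup hallM).
    - exact: pnat_coprime (pnat_pi (cardG_gt0 R)) (pHall_pgroup hallC).
  have nAr: r^-1 \in 'N(A) by rewrite groupV (subsetP nAR).
  apply/eqP; rewrite eqEsubset mul_subG ?subsetIl // andbT.
  rewrite -{1}(normP nAr) -{1}defA conjsMg mulgSS //.
    by rewrite (normP _) // groupV (subsetP (nU _ (subsetIr A R))) ?(subsetP sRG).
  rewrite subsetI -{1}(normP nAr) conjSg sCA /=.
  by rewrite sub_conjgV.
(* The index type [I] may be infinite, so the Hall set is indexed by the primes dividing the order
   of [G]; primes of one class give the same subgroup. *)
split=> //; exists [set F (p : 'I_#|G|.+1) | p : 'I_#|G|.+1 & (p : nat) \in primes #|G|].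
split; first split.
- by move=> H /imsetP[p _ ->] _; exists (sigma p); apply: hallF.
- move=> i /hasP[p p_G /eqP <-].
  have ltp: p < #|G|.+1.
    by move: p_G; rewrite mem_primes ltnS => /and3P[_ G0 /dvdn_leq->].
  exists (F p); split=> //.
    by apply/imsetP; exists (Ordinal ltp); rewrite ?inE.
  move=> _ /imsetP[q q_G ->] hallq; rewrite inE in q_G.
  suff eqs: sigma p = sigma q by rewrite /F eqs.
  move: p_G; rewrite mem_primes => /and3P[p_pr _ pG].
  apply/eqP; apply: (pgroupP (pHall_pgroup (hallF q)) p p_pr).
  rewrite (card_Hall hallq); move: (pG); rewrite -{1}(partnC (sig sigma (sigma p)) (cardG_gt0 G)).
  rewrite Euclid_dvdM // => /orP[] // p'G.
  have: p \in (sig sigma (sigma p))^' by apply: (pnatP _ (part_gt0 _ _) (part_pnat _ _)) p_pr p'G.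
  by rewrite !inE eqxx.
move=> _ /imsetP[p _ ->] x Gx; set i := sigma p.
(* With [x = m * r], [m] normalises [F p] and [r] normalises [A], so it suffices that [A] and [F p]
   permute. *)
have: x \in M * R by rewrite normC ?(subset_trans sMG) // defG.
case/mulsgP=> m r Mm Rr ->; rewrite conjsgM.
have /normP -> : m \in 'N(F p).
  apply: subsetP Mm; rewrite normsY //.
    exact: subset_trans sMG (nFR p).
  exact: char_norm (pcore_char _ _).
have /normP nAr : r \in 'N(A) by rewrite (subsetP nAR).
rewrite -{1 2}nAr -!conjsMg; congr (_ :^ r); rewrite defA defF.
have nARG: G \subset 'N(A :&: R) by rewrite nU ?subsetIr.
(* Both [A] and [F p] are products of two factors; in each of the four pairs one member normalises
   the other. *)
have cB : (A :&: M) * 'O_(sig sigma i)(M) = 'O_(sig sigma i)(M) * (A :&: M).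
  apply: normC; apply: subset_trans (subsetIr _ _) _.
  exact: char_norm (pcore_char _ _).
have cBR : (A :&: M) * 'O_(sig sigma i)(R) = 'O_(sig sigma i)(R) * (A :&: M).
  apply: normC; apply: subset_trans (subsetIl _ _) _.
  exact: subset_trans sAG (nFR p).
have cRM : (A :&: R) * 'O_(sig sigma i)(M) = 'O_(sig sigma i)(M) * (A :&: R).
  apply/esym/normC; apply: subset_trans (pcore_sub _ _) _.
  exact: subset_trans sMG nARG.
have cRR : (A :&: R) * 'O_(sig sigma i)(R) = 'O_(sig sigma i)(R) * (A :&: R).
  apply: normC; apply: subset_trans (subsetIl _ _) _.
  exact: subset_trans sAG (nFR p).
by apply: commuteM; apply/commute_sym/commuteM; apply: commute_sym.
Qed.

Lemma power_residual_PsT (I : eqType) (sigma : nat -> I) (gT : finGroupType)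
    (G R : {group gT}) :
  power_residual sigma G R -> PsT sigma G.
Proof.
move=> prR K H qKH qHG; apply: (residual_norm_sig_quasinormal prR).
  exact: subset_trans qKH.1 qHG.1.
exact: sig_quasinormal_trans_norm prR qKH qHG.
Qed.

(** * Hall cores of sigma-nilpotent groups *)

(** The product of the two cores is a normal [pi]-subgroup of [X], and its order shows that it is
    already Hall. *)
Lemma dprod_pcore_Hall (pi : nat_pred) (gT : finGroupType) (X H Y : {group gT}) :
  H \x Y = X -> pi.-Hall(H) 'O_pi(H) -> pi.-Hall(Y) 'O_pi(Y) ->
  pi.-Hall(X) 'O_pi(X).
Proof.
move=> defX hallH hallY; have [_ defXm cHY tiHY] := dprodP defX.
have [nHX nYX] := dprod_normal2 defX.
have sHY: 'O_pi(H) <*> 'O_pi(Y) \subset 'O_pi(X).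
  rewrite join_subG !pcore_max ?pcore_pgroup ?(char_normal_trans (pcore_char _ _)) //.
have defQ: 'O_pi(H) <*> 'O_pi(Y) = 'O_pi(H) * 'O_pi(Y).
  by rewrite cent_joinEr // (centSS (pcore_sub _ _) (pcore_sub _ _)).
rewrite /pHall pcore_sub pcore_pgroup /=.
apply: pnat_dvd (indexgS _ sHY) _.
have hallQ: pi.-Hall(X) ('O_pi(H) <*> 'O_pi(Y)).
  rewrite pHallE (subset_trans sHY (pcore_sub _ _)) /= defQ TI_cardMg; last first.
    by apply/trivgP; rewrite /= -tiHY setISS ?pcore_sub.
  by rewrite (card_Hall hallH) (card_Hall hallY) -partnM // -(TI_cardMg tiHY) defXm.
by have /and3P[] := hallQ.
Qed.

Lemma sig_primary_pgroup (I : eqType) (sigma : nat -> I) (pi : nat_pred)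
    (gT : finGroupType) (H : {group gT}) :
  (forall p q, sigma p = sigma q -> (p \in pi) = (q \in pi)) ->
  sig_primary sigma H -> pi.-group H \/ pi^'.-group H.
Proof.
move=> sat_pi primH; have [|pi'H] := boolP (pi.-group H); first by left.
right; apply/pgroupP=> p p_pr pH.
apply: contra pi'H => pi_p; apply/pgroupP=> q q_pr qH.
rewrite (sat_pi q p) //.
by apply: primH; apply/hasP; [exists q | exists p] => //;
  rewrite mem_primes cardG_gt0 ?q_pr ?p_pr.
Qed.

(** Each direct factor is a [pi]-group or a [pi^']-group. A general union of classes [pi] covers
    both a class and its complement. *)
Lemma sig_nilpotent_pcore_Hall (I : eqType) (sigma : nat -> I) (pi : nat_pred)
    (gT : finGroupType) (X : {group gT}) :
  (forall p q, sigma p = sigma q -> (p \in pi) = (q \in pi)) ->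
  sig_nilpotent sigma X -> pi.-Hall(X) 'O_pi(X).
Proof.
move=> sat_pi [Hs [defX primHs]]; elim: Hs X defX primHs => [|H Hs IH] X.
  rewrite big_nil => <- _.
  by rewrite nilpotent_pcore_Hall ?nilpotent1.
rewrite big_cons => defX primHs.
have [[H1 Y eqH1 defY] _ _ _] := dprodP defX.
rewrite defY in defX.
apply: dprod_pcore_Hall defX _ _; last first.
  by apply: IH defY _ => H' sH'; apply: primHs; rewrite inE sH' orbT.
have [|piH|pi'H] := sig_primary_pgroup sat_pi (primHs H _).
- exact: mem_head.
- by rewrite pcore_pgroup_id // /pHall subxx piH indexgg.
have -> : 'O_pi(H) = 1.
  apply/eqP; rewrite trivg_card1; apply/eqP/(pnat_1 (pcore_pgroup pi H)).
  exact: pgroupS (pcore_sub _ _) pi'H.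
by rewrite /pHall sub1G pgroup1 indexg1.
Qed.

Lemma sig_classP (I : eqType) (sigma : nat -> I) i p q :
  sigma p = sigma q -> (p \in sig sigma i) = (q \in sig sigma i).
Proof. by rewrite !inE => ->. Qed.

(** The core is a Hall subgroup, so its quotient is a [sigma_i]-group; conversely, every [N] with
    such a quotient contains all [sigma_i']-elements. *)
Lemma Osig_pcore (I : eqType) (sigma : nat -> I) i (gT : finGroupType)
    (D : {group gT}) :
  sig_nilpotent sigma D -> Osig sigma i D = 'O_((sig sigma i)^')(D).
Proof.
move=> nilD; set pi := sig sigma i.
have hallO: pi^'.-Hall(D) 'O_pi^'(D).
  apply: sig_nilpotent_pcore_Hall nilD => p q /(sig_classP i).
  by rewrite !(inE, unfold_in) /= => ->.
apply/eqP; rewrite eqEsubset; apply/andP; split.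
  apply: (bigcap_inf 'O_pi^'(D)%G); rewrite pcore_normal /pgroup.
  rewrite card_quotient ?gFnorm //.
  have /and3P[_ _] := hallO.
  by rewrite (eq_pnat _ (negnK pi)).
apply/bigcapsP=> N /andP[nND piN]; apply/subsetP=> x Ox.
apply: (mem_coprime_index nND); first exact: subsetP (pcore_sub _ _) x Ox.
rewrite coprime_sym; apply: pnat_coprime (mem_p_elt (pcore_pgroup _ _) Ox).
by rewrite -card_quotient ?normal_norm.
Qed.

(** * Intersections and preimages of normal subgroups with sigma-nilpotent quotient *)

(** Intersecting the witnesses works: the index is computed along the chain from [N1 :&: N2] through
    [N1 :&: (L1 :&: L2)] to [L1 :&: L2]. *)
Lemma sig_nil_modI (I : eqType) (sigma : nat -> I) (gT : finGroupType)
    (G N1 N2 : {group gT}) :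
  N1 <| G -> N2 <| G -> sig_nil_mod sigma G N1 -> sig_nil_mod sigma G N2 ->
  sig_nil_mod sigma G (N1 :&: N2).
Proof.
move=> nN1 nN2 nil1 nil2 i.
have [L1 [sNL1 nL1 iL1 i'L1]] := nil1 i; have [L2 [sNL2 nL2 iL2 i'L2]] := nil2 i.
exists (L1 :&: L2)%G; split; rewrite ?setISS ?normalI //=.
  have sI: N1 :&: N2 \subset N1 :&: (L1 :&: L2) by rewrite subsetI subsetIl setISS.
  rewrite -(Lagrange_index (subsetIr N1 (L1 :&: L2)) sI) pnatM; apply/andP; split.
    rewrite /= (setIC N1) indexgI; apply: pnat_index_sub iL1; last exact: subsetIl.
    by rewrite /normal sNL1 (subset_trans (normal_sub nL1)) ?normal_norm.
  rewrite /=; have -> : N1 :&: N2 = N1 :&: (L1 :&: L2) :&: N2.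
    by rewrite setIA (setIidPl sNL1) -setIA (setIidPr sNL2).
  rewrite indexgI; apply: pnat_index_sub iL2; last by rewrite /= setIA subsetIr.
  by rewrite /normal sNL2 (subset_trans (normal_sub nL2)) ?normal_norm.
rewrite -(Lagrange_index (normal_sub nL1) (subsetIl L1 L2)) pnatM i'L1 indexgI.
exact: pnat_index_sub nL2 (normal_sub nL1) i'L2.
Qed.

(** An empty intersection is the whole type, whence the factor [G]. *)
Lemma sig_nil_mod_bigcap (I : eqType) (sigma : nat -> I) (gT : finGroupType)
    (J : finType) (P : pred J) (F : J -> {group gT}) (G : {group gT}) :
  (forall j, P j -> F j <| G) -> (forall j, P j -> sig_nil_mod sigma G (F j)) ->
  exists M : {group gT},
    [/\ M = G :&: \bigcap_(j | P j) F j :> {set gT}, M <| G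
      & sig_nil_mod sigma G M].
Proof.
move=> nF nilF; rewrite -big_filter.
have: all P [seq j <- index_enum J | P j] by apply: filter_all.
elim: [seq _ <- _ | _] => [_ | j s IH /= /andP[Pj /IH[M [defM nM nilM]]]].
  exists G; rewrite big_nil setIT; split=> // i.
  by exists G; rewrite subxx normal_refl indexgg.
exists (F j :&: M)%G; rewrite big_cons /= normalI ?nF //; split=> //.
  by rewrite defM setICA.
by apply: sig_nil_modI; rewrite ?nF //; apply: nilF.
Qed.

Lemma sig_nil_mod_cosetpre (I : eqType) (sigma : nat -> I) (gT : finGroupType)
    (G K : {group gT}) (M : {group coset_of K}) :
  K <| G -> sig_nil_mod sigma (G / K) M ->
  sig_nil_mod sigma G (coset K @*^-1 M).
Proof.
move=> nKG nilM i; have [L [sML nL iL i'L]] := nilM i.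
exists (coset K @*^-1 L)%G; split; rewrite /= ?morphpreS ?index_cosetpre //.
  by rewrite -(quotientGK nKG) cosetpre_normal.
by rewrite -{1}(quotientGK nKG) index_cosetpre.
Qed.

Lemma sig_nilpotent_nil_mod (I : eqType) (sigma : nat -> I) (gT : finGroupType)
    (G N : {group gT}) :
  N <| G -> sig_nilpotent sigma (G / N) -> sig_nil_mod sigma G N.
Proof.
move=> nNG nilGN.
have: sig_nil_mod sigma (G / N) 1.
  move=> i; exists 'O_(sig sigma i)(G / N)%G; rewrite sub1G pcore_normal.
  have /and3P[_ piO pi'O] := sig_nilpotent_pcore_Hall (@sig_classP _ sigma i) nilGN.
  by split=> //; rewrite indexg1.
move/(sig_nil_mod_cosetpre nNG).
by rewrite (_ : (coset N @*^-1 1)%G = N) //; apply/val_inj; rewrite /= -kerE ker_coset.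
Qed.

(** * Lifting the residual of a special quotient *)

Lemma TI_norm_commute (gT : finGroupType) (A B : {group gT}) x y :
  A :&: B = 1 -> x \in A -> y \in B -> x \in 'N(B) -> y \in 'N(A) ->
  commute x y.
Proof.
move=> tiAB Ax By nBx nAy.
have ABxy: [~ x, y] \in A :&: B.
  rewrite inE {1}commgEl commgEr; apply/andP.
  by split; rewrite groupM ?groupV ?memJ_norm ?groupV.
by move: ABxy; rewrite tiAB => /set1P/eqP/commgP.
Qed.

(** [T] is the preimage of the residual, and relations in the quotient become membership in [K].
    Primes of class [i] do not divide the order of [K], so the Hall property of the residual gives
    the alternative on [T]. *)
Lemma special_PsT_kernel (I : eqType) (sigma : nat -> I) i (gT : finGroupType)
    (G K : {group gT}) :
  K <| G -> (sig sigma i)^'.-group K -> special_PsT sigma (G / K) ->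
  exists T : {group gT},
    [/\ K \subset T, T <| G, sig_nil_mod sigma G T,
        forall p, prime p -> sigma p = i -> p^'.-group T \/ p^'.-nat #|G : T|
      & (forall u x, u \in T -> x \in G ->
          exists n, (u ^+ n)^-1 * u ^ x \in K) /\
        (forall p q r b, prime p -> prime q -> p != q ->
          sigma p = sigma q -> r \in T -> b \in G -> p.-elt r -> q.-elt b ->
          [~ r, b] \in K)].
Proof.
move=> nKG i'K [k [E [hallE sD0E [hallD0 powD0] [S defE]]]].
have sEG := pHall_sub hallE.
have [||M [defM nMG nilM]] := @sig_nil_mod_bigcap _ sigma _ _
  [pred N : {group coset_of K} | (N <| G / K) && asb (sig_nilpotent sigma (G / K / N))]
  id (G / K)%G.
- by move=> N /andP[].
- move=> N /andP[nN nilN]; apply: sig_nilpotent_nil_mod => //.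
  by move: nilN; rewrite /asb; case: ClassicalEpsilon.excluded_middle_informative.
(* Intersecting with [G / K] is harmless because the residual lies in [E]. *)
have {}defM: sig_nil_res sigma (G / K) = M.
  by rewrite defM; apply/esym/setIidPr; apply: subset_trans sD0E sEG.
rewrite {}defM in sD0E hallD0 powD0 defE.
have [nKG' sMG] := (normal_norm nKG, normal_sub nMG).
exists (coset K @*^-1 M)%G; split.
- by rewrite sub_cosetpre.
- by rewrite -(quotientGK nKG) cosetpre_normal.
- exact: sig_nil_mod_cosetpre.
- move=> p p_pr sp; have /andP[_ coM] := hallD0.
  have p'K: p^'.-group K.
    apply: sub_in_pnat i'K => q _; apply: contraNN => /eqP->.
    by rewrite inE sp.
  have [p'M | pM] := boolP (p^'.-group M); [left | right].
    by rewrite /pgroup card_cosetpre pnatM; apply/andP.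
  rewrite -{1}(quotientGK nKG) index_cosetpre p'natE //.
  rewrite /pgroup p'natE // negbK in pM.
  by rewrite -prime_coprime // (coprime_dvdl pM).
split=> [u x /morphpreP[Nu Mu] Gx | p q r b p_pr q_pr neq_pq sq /morphpreP[Nr Mr] Gb pr qb].
  have Nx := subsetP nKG' x Gx; rewrite /= in Mu.
  have /powD0/(_ <[coset K u]>%G): coset K x \in G / K by rewrite mem_quotient.
  rewrite cycle_subG => /(_ Mu) defu.
  have: coset K u ^ coset K x \in <[coset K u]> :^ coset K x.
    by rewrite memJ_conjg cycle_id.
  rewrite {}defu => /cycleP[n]; rewrite -morphJ // -morphX // => eq_n; exists n.
  apply: coset_idr; first by rewrite groupM ?groupV ?groupX ?groupJ.
  by rewrite morphM ?groupV ?groupX ?groupJ // morphV ?groupX //= eq_n mulVg.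
have Nb := subsetP nKG' b Gb; rewrite /= in Mr.
apply: coset_idr; first by rewrite groupR.
rewrite morphR //=; apply/eqP/commgP.
have {}Gb : coset K b \in G / K by rewrite mem_quotient.
have {}pr : p.-elt (coset K r) by rewrite morph_p_elt.
have {}qb : q.-elt (coset K b) by rewrite morph_p_elt.
move: (coset K r) (coset K b) Mr Gb pr qb => {Nr Nb}r {}b Mr Gb pr qb.
have [-> | r1] := eqVneq r 1; first exact: commute_sym (commute1 _).
have sk: sigma p = k.
  rewrite -cycle_eq1 in r1; have [_ pr' _] := pgroup_pdiv pr r1.
  apply/eqP/(pgroupP (pHall_pgroup hallE) p p_pr).
  by apply: dvdn_trans pr' _; rewrite order_dvdG // (subsetP sD0E).
(* [M] is a [sigma_k]-group, hence so is [L]; thus [L] is a normal Hall subgroup and equals [E]. *)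
have Eb: b \in E.
  have [L [sML nLG iL i'L]] := nilM k.
  have kL: (sig sigma k).-group L.
    have kM := pgroupS sD0E (pHall_pgroup hallE).
    by rewrite /pgroup -(Lagrange sML) pnatM; apply/andP.
  have hallL: (sig sigma k).-Hall(G / K) L by rewrite /pHall normal_sub //= kL.
  have sEL: E \subset L by rewrite (sub_normal_Hall hallL) ?(pHall_pgroup hallE).
  have /eqP->: E :==: L.
    by rewrite eqEcard sEL (card_Hall hallL) (card_Hall hallE) leqnn.
  apply: (mem_coprime_index nLG Gb); apply: pnat_coprime _ i'L.
  by apply: sub_in_pnat qb => s _ /eqP->; rewrite inE -sq sk.
have nMb: b \in 'N(M) by rewrite (subsetP (normal_norm nMG)).
have normM x y : x \in M -> y \in G / K -> y \in 'N(<[x]>).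
  by move=> Mx Gy; apply/normP/powD0; rewrite ?cycle_subG.
have [coMb | Mb] := Hall_pi'_or_sub q_pr nMG hallD0 Gb qb.
  (* The order of [b] is prime to the index of [S] in [E], so [b] lies in [S]; now [S] and [M] meet
     trivially and [r], [b] normalise them respectively. *)
  have [nSE sME defE' nSM tiSM] := sdprod_context defE.
  have Sb: b \in S.
    apply: (mem_coprime_index nSE Eb); rewrite coprime_sym.
    suff ->: #|E : S| = #|M| by [].
    by apply/eqP; rewrite -(eqn_pmul2l (cardG_gt0 S)) Lagrange ?normal_sub //
      (sdprod_card defE).
  apply/commute_sym; apply: (TI_norm_commute tiSM Sb Mr nMb).
  exact: subsetP nSM r Mr.
(* When [b] is in [M], both cyclic subgroups are normal and have coprime orders. *)
have tirb: <[r]> :&: <[b]> = 1.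
  apply: coprime_TIg; apply: pnat_coprime pr _; apply: sub_in_pnat qb => s _ /eqP->.
  by rewrite !inE eq_sym.
apply: (TI_norm_commute tirb (cycle_id r) (cycle_id b)).
  exact: normM Mb (subsetP sMG r Mr).
exact: normM Mr Gb.
Qed.

(** * Construction of the power residual of [G] *)

Theorem theoremB (I : eqType) (sigma : nat -> I) (gT : finGroupType)
    (G D : {group gT}) :
  D <| G -> Hall G D ->
  sig_nilpotent sigma D ->
  sig_nilpotent sigma (G / D) ->
  (forall i, sig_of sigma #|D| i -> special_PsT sigma (G / Osig sigma i D)) ->
  PsT sigma G.
Proof.
move=> nDG hallD nilD nilGD specG.
(* [K p] equals [Osig] for the class of [p], and [B p] is its complement in [D]: an element of [B p]
   that is trivial modulo [K p] is trivial. *)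
pose K p := 'O_((sig sigma (sigma p))^')(D)%G.
pose B p := 'O_(sig sigma (sigma p))(D)%G.
have hallK p : (sig sigma (sigma p))^'.-Hall(D) (K p).
  apply: sig_nilpotent_pcore_Hall nilD => q s /(sig_classP (sigma p)).
  by rewrite !(inE, unfold_in) /= => ->.
have hallB p : (sig sigma (sigma p)).-Hall(D) (B p).
  exact: sig_nilpotent_pcore_Hall (@sig_classP _ sigma (sigma p)) nilD.
have nKG p : K p <| G by apply: char_normal_trans (pcore_char _ _) nDG.
have nBG p : B p <| G by apply: char_normal_trans (pcore_char _ _) nDG.
have tiBK p x : x \in B p -> x \in K p -> x = 1.
  have tiBKp: B p :&: K p = 1.
    exact: coprime_TIg (pnat_coprime (pcore_pgroup _ _) (pcore_pgroup _ _)).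
  by move=> Bx Kx; apply/set1gP; rewrite -tiBKp inE Bx.
have memB (p : nat) x : x \in D -> p.-elt x -> x \in B p.
  move=> Dx px; rewrite (mem_normal_Hall (hallB p) (pcore_normal _ _) Dx).
  by apply: sub_in_pnat px => s _ /eqP->; rewrite !inE.
pose pT p (T : {group gT}) :=
    [/\ K p \subset T, T <| G, sig_nil_mod sigma G T,
        forall q, prime q -> sigma q = sigma p -> q^'.-group T \/ q^'.-nat #|G : T|
      & (forall u x, u \in T -> x \in G ->
          exists n, (u ^+ n)^-1 * u ^ x \in K p) /\
        (forall q s r b, prime q -> prime s -> q != s ->
          sigma q = sigma s -> r \in T -> b \in G -> q.-elt r -> s.-elt b ->
          [~ r, b] \in K p)].
(* Primes dividing the order of [D] stand for their classes, giving a finite index type; elsewhere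
   [T] takes the dummy value [G]. *)
pose J := 'I_#|D|.+1; pose P (p : J) := (p : nat) \in primes #|D|.
have /fin_all_exists[T TP] (p : J) : exists T : {group gT}, P p -> pT p T.
  have [Pp | _] := boolP (P p); last by exists G.
  have [|T pTT] := @special_PsT_kernel _ sigma (sigma p) _ G (K p) (nKG p) (pcore_pgroup _ _).
    have: special_PsT sigma (G / Osig sigma (sigma p) D).
      by apply: specG; apply/hasP; exists (p : nat).
    by rewrite (Osig_pcore _ nilD).
  by exists T.
have [||M [defM nMG nilM]] := @sig_nil_mod_bigcap _ sigma _ _ P T G.
- by move=> p /TP[].
- by move=> p /TP[].
have sMT p : P p -> M \subset T p.
  by move=> Pp; rewrite defM subIset // bigcap_inf ?orbT.
pose R := (D :&: M)%G.
have sRD: R \subset D by apply: subsetIl.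
have nRG: R <| G by apply: normalI.
have indR (p : nat) r : prime p -> r \in R -> p.-elt r -> r != 1 ->
    exists2 j : J, j = p :> nat & P j.
  move=> p_pr Rr pr r1; rewrite -cycle_eq1 in r1.
  have [_ pr' _] := pgroup_pdiv pr r1.
  have pD: p %| #|D| by apply: dvdn_trans pr' _; rewrite order_dvdG // (subsetP sRD).
  have ltp: p < #|D|.+1 by rewrite ltnS dvdn_leq.
  by exists (Ordinal ltp) => //; rewrite /P mem_primes p_pr cardG_gt0.
apply: (@power_residual_PsT _ sigma _ G R); split=> //.
- rewrite /Hall normal_sub //=.
  apply: (pnat_coprime (pnat_pi (cardG_gt0 R))); apply/pnatP=> // p p_pr pGR.
  apply/negP; rewrite /= mem_primes => /and3P[_ _ pR].
  have pD: p %| #|D| := dvdn_trans pR (cardSg sRD).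
  (* Then [R] contains a Sylow [p]-subgroup of [G], contradicting that [p] divides its index. *)
  have memR x : x \in G -> p.-elt x -> x \in R.
    move=> Gx px.
    have Dx: x \in D.
      rewrite (mem_normal_Hall (Hall_pi hallD) nDG Gx).
      by apply: sub_in_pnat px => q _ /eqP->; rewrite /= mem_primes p_pr cardG_gt0.
    rewrite inE Dx defM inE Gx; apply/bigcapP=> q Pq.
    have [sKT nTG _ hallT _] := TP q Pq.
    (* In the class of [q], [p] divides the order of [R] and hence of [T q], so the index of [T q]
       is prime to [p]; in another class [x] already lies in [K q]. *)
    have [sp | neqs] := eqVneq (sigma p) (sigma q).
      have [p'T | p'GT] := hallT p p_pr sp.
        have p'R: p^'.-group R := pgroupS (subset_trans (subsetIr _ _) (sMT q Pq)) p'T.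
        by rewrite /pgroup p'natE // pR in p'R.
      by apply: (mem_coprime_index nTG Gx); apply: pnat_coprime px p'GT.
    apply: (subsetP sKT); rewrite (mem_normal_Hall (hallK q) (pcore_normal _ _) Dx).
    by apply: sub_in_pnat px => s _ /eqP->; rewrite !inE.
  have [Q sylQ] := Sylow_exists p G; have [sQG pQ p'GQ] := and3P sylQ.
  have sQR: Q \subset R.
    by apply/subsetP=> x Qx; rewrite memR ?(subsetP sQG) // (mem_p_elt pQ).
  move: (pnat_dvd (indexgS G sQR) p'GQ).
  by rewrite p'natE // pGR.
- move=> U sUR; apply/subsetP=> x Gx; rewrite inE sub_conjg.
  apply: sub_of_pelts => p u p_pr Uu pu; rewrite mem_conjgV.
  have Ru := subsetP sUR u Uu; have Du := subsetP sRD u Ru.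
  have [-> | u1] := eqVneq u 1; first by rewrite conj1g group1.
  have [j def_j Pj] := indR p u p_pr Ru pu u1.
  have [_ _ _ _ [powT _]] := TP j Pj.
  have Tu : u \in T j by apply: (subsetP (sMT j Pj)); case/setIP: Ru.
  (* The congruence modulo [K p] is an equality, because [u] and [u ^ x] lie in [B p]. *)
  have [n] := powT u x Tu Gx; rewrite def_j => Kn.
  have Bu := memB p u Du pu.
  have: (u ^+ n)^-1 * u ^ x = 1.
    apply: (tiBK p) Kn; rewrite groupM ?groupV ?groupX //.
    by rewrite memJ_norm // (subsetP (normal_norm (nBG p))).
  by move/eqP; rewrite -eq_mulVg1 => /eqP <-; rewrite groupX.
- apply: sig_nil_modI => //; exact: sig_nilpotent_nil_mod.
move=> p q r b p_pr q_pr neq_pq sq Rr Gb pr qb.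
have [-> | r1] := eqVneq r 1; first exact: commute_sym (commute1 _).
have [j def_j Pj] := indR p r p_pr Rr pr r1.
have [_ _ _ _ [_ commT]] := TP j Pj.
have Tr : r \in T j by apply: (subsetP (sMT j Pj)); case/setIP: Rr.
have Br := memB p r (subsetP sRD r Rr) pr.
apply/commgP/eqP; apply: (tiBK p); last first.
  by rewrite -def_j; apply: commT neq_pq _ _ _ _ _.
rewrite commgEl groupM ?groupV // memJ_norm //.
by rewrite (subsetP (normal_norm (nBG p))).
Qed.
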